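(* For any non-negative integers $v,h$ and any integer $a$, the set $$\mathbb{B}_{v+1,h+1,a}:=\{\sigma(\mathbf{x})\mid\mathbf{x}\in\mathbb{Y}_{v+1,h+1,a}\}$$ is perfect for balanced adjacent deletions; that is, for different $\mathbf{c},\mathbf{c}'\in\mathbb{B}_{v+1,h+1,a}$ one has $\mathrm{dS}(\mathbf{c})\cap\mathrm{dS}(\mathbf{c}')=\emptyset$, and $\bigcup_{\mathbf{c}\in\mathbb{B}_{v+1,h+1,a}}\mathrm{dS}(\mathbf{c})=\mathbb{Y}_{v,h}$.
   Context: $\mathbb{Y}_{v,h}$ is the set of bit sequences in $\{0,1\}^{v+h}$ with exactly $v$ zeros and $h$ ones. For a bit sequence $\mathbf{x}$, $\mathrm{inv}(\mathbf{x})=\#\{(i,j)\mid i<j,\ x_i>x_j\}$. $\mathbb{Y}_{v,h,a}:=\{\mathbf{x}\in\mathbb{Y}_{v,h}\mid\mathrm{inv}(\mathbf{x})\equiv a\pmod{v+h}\}$ (so for $\mathbb{Y}_{v+1,h+1,a}$ the modulus is $v+h+2$). The azby permutation is $\sigma(x_1x_2x_3\cdots x_{n-1}x_n):=x_1x_nx_2x_{n-1}x_3\cdots$. A balanced adjacent deletion (BAD) deletes two adjacent bits of a sequence that form a subword $01$ or $10$. For a bit sequence $\mathbf{c}$, $\mathrm{dS}(\mathbf{c})$ is the set of all sequences obtained from $\mathbf{c}$ by a single BAD. *)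

(* Defs.v *)
From mathcomp Require Import all_boot all_order all_algebra.
From mathcomp Require Import boolp classical_sets.

Set Implicit Arguments.
Unset Strict Implicit.
Unset Printing Implicit Defensive.

Local Open Scope classical_set_scope.

Definition inversions (x : bitseq) : nat :=
  #|[pred p : 'I_(size x) * 'I_(size x) |
      (p.1 < p.2) && (nth false x p.2 < nth false x p.1)]|.

Definition Y (v h : nat) : set bitseq :=
  [set x | [/\ size x = v + h, count_mem false x = v & count_mem true x = h]].

Definition Ymod (v h : nat) (a : int) : set bitseq :=
  [set x | Y v h x /\ ((inversions x)%:Z = a %[mod (v + h)%N%:Z])%Z].

(* With 0-based indices, position 2k of the image of x_0 ... x_(n-1) holds x_k
   and position 2k+1 holds x_(n-1-k). *)
Definition azby (x : bitseq) : bitseq :=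
  mkseq (fun i => nth false x (if odd i then (size x).-1 - i./2 else i./2))
        (size x).

Definition BAD (c d : bitseq) : Prop :=
  exists (u w : bitseq) (b : bool), c = u ++ [:: b, ~~ b & w] /\ d = u ++ w.

Definition dS (c : bitseq) : set bitseq := [set d | BAD c d].

Definition Bcode (v h : nat) (a : int) : set bitseq :=
  [set azby x | x in Ymod v h a].

(* Main.v *)
(* Write [c = azby x] and follow [inv x] as a function of [c].  If [c] arises
   from [d], of length [n], by inserting an unequal pair after a prefix [u], with
   [d = u ++ w], then [inv] grows by [s u] or by [s u + |w| + 1], depending on
   the order of the pair, where [s u] counts the ones at even and the zeros at
   odd positions of [u].  Along the prefixes of [d] the first quantity climbs
   from [0] to [s d] and the second descends from [n + 1] to [s d + 1], both in
   steps of at most one, so every residue mod [n + 2] is attained; and two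
   insertions with the same growth yield the same word, since a step is
   stationary exactly when the inserted pair can slide over the next letter. *)
Require Import Defs.
From mathcomp Require Import all_boot all_order all_algebra.
From mathcomp Require Import boolp classical_sets.
From mathcomp Require Import zify.

Local Open Scope classical_set_scope.

Lemma inversionsE (x : bitseq) :
  inversions x = \sum_(i < size x) \sum_(j < size x)
    ((i < j) && (nth false x j < nth false x i)).
Proof.
rewrite /inversions -sum1_card pair_big big_mkcond /=.
by apply: eq_bigr => -[i j] _; rewrite inE /=; case: (_ && _).
Qed.

Lemma sum_nth_false (x : bitseq) :
  \sum_(i < size x) (nth false x i < true) = count_mem false x.
Proof.
elim: x => [|b x IHx]; first by rewrite big_ord0.
by rewrite big_ord_recl /= IHx; case: b.
Qed.

Lemma inversions_cons (b : bool) (x : bitseq) :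
  inversions (b :: x) = b * count_mem false x + inversions x.
Proof.
rewrite !inversionsE /= big_ord_recl /= big_ord_recl /= add0n.
congr (_ + _).
  case: b; last by rewrite big1 // => i _; case: nth.
  by rewrite mul1n -sum_nth_false; apply: eq_bigr.
by apply: eq_bigr => i _; rewrite big_ord_recl /= add0n; apply: eq_bigr.
Qed.

Lemma count_false_cons (b : bool) (x : bitseq) :
  count_mem false (b :: x) = ~~ b + count_mem false x.
Proof. by case: b. Qed.

Lemma count_true_cons (b : bool) (x : bitseq) :
  count_mem true (b :: x) = b + count_mem true x.
Proof. by case: b. Qed.

Lemma inversions_rcons (b : bool) (x : bitseq) :
  inversions (rcons x b) = inversions x + ~~ b * count_mem true x.
Proof.
elim: x => [|c x IHx] /=.
  by rewrite muln0 inversions_cons muln0 addn0.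
rewrite !inversions_cons IHx -cats1 count_cat /=.
by case: b c IHx => [] [] _ /=; lia.
Qed.

(** Each pair of unequal letters is inverted in exactly one of a word and its reversal. *)
Lemma inversions_rev (x : bitseq) :
  inversions (rev x) + inversions x = count_mem false x * count_mem true x.
Proof.
elim: x => [|b x IHx]; first by rewrite inversionsE big_ord0.
rewrite rev_cons inversions_rcons inversions_cons count_rev.
by rewrite count_false_cons count_true_cons; case: b; lia.
Qed.

(** The inverse of [azby]: once the first letter is read, the azby reading continues from the other
    end, hence the reversal of the tail. *)
Fixpoint unazby (c : bitseq) : bitseq :=
  if c is b :: c' then b :: rev (unazby c') else [::].

Lemma size_azby (x : bitseq) : size (azby x) = size x.
Proof. exact: size_mkseq. Qed.

Lemma azby_cons_rev (b : bool) (x : bitseq) : azby (b :: rev x) = b :: azby x.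
Proof.
have sz_rev : size (b :: rev x) = (size x).+1 by rewrite /= size_rev.
apply: (@eq_from_nth _ false); first by rewrite !size_azby sz_rev /= size_azby.
rewrite size_azby sz_rev => -[|i] lt_i; first by rewrite nth_mkseq ?sz_rev.
rewrite [RHS]/= !nth_mkseq ?sz_rev // [odd _]/= [_./2]/= [_.-1]/=.
have [odd_i|even_i] /= := boolP (odd i).
  rewrite uphalf_half odd_i add1n.
  by rewrite /= nth_rev; [congr nth; lia | lia].
rewrite uphalf_half (negbTE even_i) add0n.
have -> : size x - i./2 = (size x - i./2).-1.+1 by lia.
by rewrite /= nth_rev; [congr nth; lia | lia].
Qed.

Lemma unazbyK (c : bitseq) : azby (unazby c) = c.
Proof. by elim: c => //= b c IHc; rewrite azby_cons_rev IHc. Qed.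

Lemma azbyK (x : bitseq) : unazby (azby x) = x.
Proof.
have [n] := ubnP (size x); elim: n x => // n IHn [|b x] // lt_x.
by rewrite -[x]revK azby_cons_rev /= IHn // size_rev.
Qed.

Lemma count_unazby (p : pred bool) (c : bitseq) :
  count p (unazby c) = count p c.
Proof. by elim: c => //= b c IHc; rewrite count_rev IHc. Qed.

Lemma count_false_true (c : bitseq) :
  count_mem false c + count_mem true c = size c.
Proof. by elim: c => //= -[] c <-; lia. Qed.

Lemma YE (v h : nat) (x : bitseq) :
  Y v h x <-> count_mem false x = v /\ count_mem true x = h.
Proof.
by split=> [[]//|[<- <-]]; split; rewrite // count_false_true.
Qed.

Lemma BcodeE (v h : nat) (a : int) (c : bitseq) :
  Bcode v h a c <->
  Y v h c /\ ((inversions (unazby c))%:Z = a %[mod (v + h)%N%:Z])%Z.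
Proof.
have YZ d : Y v h (unazby d) <-> Y v h d by rewrite !YE !count_unazby.
split=> [[x [Yx ax] <-]|[Yc ac]].
  by rewrite -YZ azbyK.
by exists (unazby c); rewrite ?unazbyK //; split=> //; apply/YZ.
Qed.

Lemma inversions_unazby_cons (b : bool) (c : bitseq) :
  inversions (unazby (b :: c)) + inversions (unazby c)
  = b * count_mem false c + count_mem false c * count_mem true c.
Proof.
by rewrite /= inversions_cons count_rev -addnA inversions_rev !count_unazby.
Qed.

(* The number of ones at even plus zeros at odd positions of [u]: passing to the
   tail exchanges the two parities. *)
Fixpoint weight (u : bitseq) : nat :=
  if u is b :: u' then b + (size u' - weight u') else 0.

Lemma weight_le_size (u : bitseq) : weight u <= size u.
Proof. by elim: u => //= -[] u IHu; lia. Qed.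

Lemma weight_rcons (u : bitseq) (x : bool) :
  weight (rcons u x) = weight u + (x (+) odd (size u)).
Proof.
elim: u => [|b u IHu] /=; first by case: x.
rewrite IHu size_rcons; have := weight_le_size u.
by case: x {IHu} (odd _) => [] [] /=; lia.
Qed.

Lemma weight_cat (u t : bitseq) :
  weight u <= weight (u ++ t) <= weight u + size t.
Proof.
elim: t u => [|x t IHt] u; first by rewrite cats0 addn0 leqnn.
rewrite -cat_rcons; have := IHt (rcons u x); rewrite weight_rcons /=.
by case: (_ (+) _); lia.
Qed.

(** [b (+) odd (size u)] says whether [b], placed right after [u], would count towards [weight];
    this selects the order of the pair with the larger growth. *)
Definition growth (u : bitseq) (b : bool) (w : bitseq) : nat :=
  weight u + (b (+) odd (size u)) * (size w).+1.

Lemma growth_le (u : bitseq) (b : bool) (w : bitseq) :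
  growth u b w < (size (u ++ w)).+2.
Proof.
rewrite /growth size_cat; have := weight_le_size u.
by case: (_ (+) _); lia.
Qed.

(** By [inversions_unazby_cons], prepending [x] to both words turns an increase [g] into
    [x + size (u ++ w) + 1 - g]; [growth] obeys the same recursion because the parity of the
    insertion point flips. *)
Lemma inversions_insert (u : bitseq) (b : bool) (w : bitseq) :
  inversions (unazby (u ++ [:: b, ~~ b & w]))
  = inversions (unazby (u ++ w)) + growth u b w.
Proof.
rewrite /growth; elim: u => [|x u IHu].
  have := inversions_unazby_cons b (~~ b :: w).
  have := inversions_unazby_cons (~~ b) w.
  have := count_false_true w.
  rewrite !cat0s !(count_false_cons, count_true_cons) [weight _]/= [odd _]/=.
  by case: b; nia.
have := inversions_unazby_cons x (u ++ [:: b, ~~ b & w]).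
have := inversions_unazby_cons x (u ++ w).
have := count_false_true (u ++ w); have := weight_le_size u.
rewrite !cat_cons !count_cat !(count_false_cons, count_true_cons) size_cat IHu.
rewrite [weight (x :: u)]/= [odd (size (x :: u))]/=.
by case: b x {IHu} (odd _) => [] [] []; nia.
Qed.

(** The hypothesis is an extreme case of [weight_cat]: either all letters of [t] count or none does.
    So [t] alternates starting with [b], and [b, ~~ b, b] is a pair before [b] as well as a pair
    after [b]. *)
Lemma insert_slide (e : bool) (u t w : bitseq) :
  weight (u ++ t) = weight u + e * size t ->
  let b := e (+) odd (size u) in
  let b' := e (+) odd (size (u ++ t)) in
  u ++ [:: b, ~~ b & t ++ w] = (u ++ t) ++ [:: b', ~~ b' & w].
Proof.
elim: t u => [|x t IHt] u /=; first by rewrite cats0.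
rewrite -(cat_rcons x u t) => wt; have wx := weight_rcons u x.
have xE : x (+) odd (size u) = e.
  have := weight_cat (rcons u x) t.
  by case: (e) (x (+) _) wx wt => [] [] /=; lia.
rewrite -IHt; last by rewrite wt wx xE; case: (e) => /=; lia.
rewrite size_rcons /= -xE -addbA addbb addbF cat_rcons.
by case: x (odd _) {wt wx xE IHt} => [] [].
Qed.

Lemma growth_inj_le (u t w : bitseq) (b b' : bool) :
  growth u b (t ++ w) = growth (u ++ t) b' w ->
  u ++ [:: b, ~~ b & t ++ w] = (u ++ t) ++ [:: b', ~~ b' & w].
Proof.
rewrite /growth size_cat; set e := b (+) _; set e' := b' (+) _ => eq_g.
have wc := weight_cat u t.
(* The weights of [u] and [u ++ t] differ by at most [size t], which cannot absorb an unmatched term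
   [(size w).+1]. *)
have eE : e = e' by case: e e' eq_g => [] [] //=; lia.
have bE : b = e (+) odd (size u) by rewrite /e -addbA addbb addbF.
have b'E : b' = e (+) odd (size (u ++ t)).
  by rewrite eE /e' -addbA addbb addbF.
rewrite bE b'E; apply: insert_slide.
by move: eq_g; rewrite -eE; case: (e) => /=; lia.
Qed.

Lemma growth_inj (u w u' w' : bitseq) (b b' : bool) :
  u ++ w = u' ++ w' -> growth u b w = growth u' b' w' ->
  u ++ [:: b, ~~ b & w] = u' ++ [:: b', ~~ b' & w'].
Proof.
wlog le_u : u w b u' w' b' / size u <= size u'.
  move=> IH eq_d eq_g; have [/IH|/ltnW/IH] := leqP (size u) (size u').
    exact.
  by move=> /(_ w' b' w b (esym eq_d) (esym eq_g)).
move=> eq_d.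
have [t uE] : exists t, u' = u ++ t.
  exists (drop (size u) u'); rewrite -[LHS](cat_take_drop (size u)).
  have := congr1 (take (size u)) eq_d.
  by rewrite take_size_cat // takel_cat // => <-.
move: eq_d; rewrite uE -catA => /eqP; rewrite eqseq_cat // eqxx => /eqP ->.
exact: growth_inj_le.
Qed.

(** Both endpoints are growths at the split [u], [w]. Moving one letter from [w] to [u] removes
    exactly one endpoint from the interval, so [t] is that endpoint or is reached by induction. *)
Lemma growth_surj (u w : bitseq) (t : nat) :
  weight u <= t <= weight u + (size w).+1 ->
  exists u1 w1 b, u ++ w = u1 ++ w1 /\ growth u1 b w1 = t.
Proof.
elim: w u => [|x w IHw] u bd_t; last first.
  have [t_in|t_out] :=
      boolP (weight (rcons u x) <= t <= weight (rcons u x) + (size w).+1).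
    by have := IHw _ t_in; rewrite cat_rcons.
  have [tE|tE] : t = weight u \/ t = weight u + (size w).+2.
    by move: bd_t t_out; rewrite weight_rcons /=; case: (_ (+) _); lia.
  - exists u, (x :: w), (odd (size u)); split=> //.
    by rewrite /growth addbb addn0.
  - exists u, (x :: w), (~~ odd (size u)); split=> //.
    by rewrite /growth addNb addbb mul1n.
exists u, [::], ((t != weight u) (+) odd (size u)); split=> //.
rewrite /growth -addbA addbb addbF /=.
by case: eqP bd_t => [->|] /=; lia.
Qed.

Lemma Y_insert (v h : nat) (u w : bitseq) (b : bool) :
  Y v.+1 h.+1 (u ++ [:: b, ~~ b & w]) <-> Y v h (u ++ w).
Proof.
by rewrite !YE !count_cat !(count_false_cons, count_true_cons); case: b; lia.
Qed.

Theorem theorem9p1 (v h : nat) (a : int) :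
  (forall c c' : bitseq,
      Bcode v.+1 h.+1 a c -> Bcode v.+1 h.+1 a c' -> c <> c' ->
      dS c `&` dS c' = set0)
  /\ \bigcup_(c in Bcode v.+1 h.+1 a) dS c = Y v h.
Proof.
have modE : v.+1 + h.+1 = (v + h).+2 by rewrite addSn addnS.
split=> [c c' /BcodeE[Yc ac] /BcodeE[_ ac'] neq_c|].
  apply/seteqP; split=> // d [[u [w [b [cE dE]]]] [u' [w' [b' [c'E dE']]]]].
  case: neq_c; rewrite cE c'E.
  have eq_d : u ++ w = u' ++ w' by rewrite -dE.
  apply: growth_inj => //.
  have [szd _ _] : Y v h (u ++ w) by apply/(Y_insert _ _ _ _ b); rewrite -cE.
  (* Both growths lie below the modulus, so their congruence is an equality. *)
  have := growth_le u b w; have := growth_le u' b' w'; rewrite -eq_d szd.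
  move=> lt' lt; move: ac'; rewrite -ac cE c'E !inversions_insert -eq_d modE.
  rewrite !modz_nat => -[] /eqP; rewrite eqn_modDl !modn_small //.
  by move=> /eqP.
apply/seteqP; split=> [d [c /BcodeE[Yc _] [u [w [b [cE ->]]]]]|d Yd].
  by apply/(Y_insert _ _ _ _ b); rewrite -cE.
pose m := (v + h).+2; pose I := inversions (unazby d).
have [szd _ _] := Yd.
(* [r] is the growth required to bring the inversions of [d] to the residue [a]. *)
have [r rE] : exists r : nat, ((a - I%:Z) %% m = r%:Z)%Z.
  exists (absz ((a - I%:Z) %% m)%Z).
  by rewrite gez0_abs // modz_ge0.
have lt_r : r < m.
  by have := ltz_pmod (a - I%:Z)%R (isT : (0 < m%:Z :> int)%R); rewrite rE.
(* From the empty prefix the attained growths run from 0 to [(v + h).+1], a full set of residues. *)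
have [|u [w [b [dE gE]]]] := @growth_surj [::] d r.
  by rewrite szd.
rewrite /= in dE; exists (u ++ [:: b, ~~ b & w]); last by exists u, w, b.
apply/BcodeE; split; first by apply/Y_insert; rewrite -dE.
rewrite inversions_insert -dE gE modE PoszD -rE modzDmr.
by rewrite GRing.addrC GRing.subrK.
Qed.
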